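(* Let $\alpha<0$, let $B$ be a measure on $]0,1[$ with $\int_0^1 y(1-y)B(dy)<\infty$ and $B(]0,1[)>0$, let $\mu_0$ be a measure on $]0,\infty[$ with $\int_0^\infty x\mu_0(dx)=1$, and let $(\mu_t,t\ge0)$ be the solution of the fragmentation equation with parameters $(\alpha,B)$ starting from $\mu_0$ that is constructed via a subordinator (see context). Let $m(t)=\int_0^\infty x\,\mu_t(dx)$. Assume that $\mu_0$ possesses a density $u_0$ in a neighborhood of $\infty$ such that $u_0(x)\sim Cx^{-\gamma}$ as $x\to\infty$, for some $\gamma>2$ and $C>0$. Then $$m(t)\sim C'\,t^{(\gamma-2)/\alpha}\qquad\text{as }t\to\infty,$$ with $C'=|\alpha|^{-1}C\int_0^\infty\overline m(u)\,u^{(2-\gamma)/\alpha-1}\,du<\infty$, where $\overline m$ denotes the total mass $\overline m(t)=\int_0^\infty x\,\overline\mu_t(dx)$ of the solution $(\overline\mu_t,t\ge0)$ of the fragmentation equation with the same parameters $\alpha,B$ and with initial measure $\delta_1$, the Dirac mass at $1$.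
   Context: Construction of the solution starting from a measure $\mu_0$ with $\int x\mu_0(dx)=1$: let $\xi$ be a subordinator (nondecreasing Lévy process) with $\xi_0=0$, zero drift and Lévy measure $\Pi$ defined by $\int_0^\infty g(x)\Pi(dx)=\int_0^1g(-\ln x)\,x\,B(dx)$ for measurable $g\ge0$. For $t\ge0$, $\mu_t$ is the measure on $]0,\infty[$ with $$\int_0^\infty f(x)\,x\,\mu_t(dx)=\int_0^\infty\mathbb E\big[f\big(x\exp(-\xi_{\rho(x^\alpha t)})\big)\big]\,x\,\mu_0(dx)$$ for all measurable $f:[0,\infty[\to[0,\infty[$ with $f(0)=0$, where $\rho(s)=\inf\{u\ge0:\int_0^u\exp(\alpha\xi_r)dr>s\}$, with $\inf\emptyset=\infty$ and $\exp(-\xi_\infty)=0$. (It is a solution of $\partial_t\int f\,d\mu_t=\int_0^\infty x^\alpha(\int_0^1(f(yx)-f(x)y)B(dy))\mu_t(dx)$ for $f$ continuously differentiable with compact support in $]0,\infty[$; for $\mu_0=\delta_1$ it is the unique solution with total mass $\int x\mu_t(dx)\le1$ that preserves upper bounds of the support.) *)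

(* Defs.v *)
From HB Require Import structures.
From mathcomp Require Import all_boot all_order all_algebra.
From mathcomp Require Import all_classical all_reals all_analysis.
Set Implicit Arguments.
Unset Strict Implicit.
Unset Printing Implicit Defensive.
Import Order.TTheory GRing.Theory Num.Theory.
Import numFieldNormedType.Exports.
Local Open Scope classical_set_scope.
Local Open Scope ring_scope.
Local Open Scope ereal_scope.

(* Measures on a Borel subset D of the line are measures on R that do not
   charge the complement of D. *)
Definition concentrated_on (R : realType) (D : set R)
    (mu : {measure set R -> \bar R}) : Prop :=
  mu (~` D) = 0.

Definition total_mass (R : realType) (mu : {measure set R -> \bar R}) : \bar R :=
  \int[mu]_(x in `]0%R, +oo[) x%:E.

Section subordinator.
Context (d : measure_display) (T : measurableType d) (R : realType).
Context (P : probability T R).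

Definition mutually_independent (n : nat) (X : 'I_n -> T -> R) : Prop :=
  forall A : 'I_n -> set R, (forall i, measurable (A i)) ->
    P (\bigcap_(i in [set: 'I_n]) (X i @^-1` A i)) =
    \prod_(i < n) P (X i @^-1` A i).

Definition independent_increments (xi : R -> {RV P >-> R}) : Prop :=
  forall (n : nat) (t : nat -> R), (0 <= t 0%N)%R ->
    (forall i, (t i <= t i.+1)%R) ->
    mutually_independent
      (fun (i : 'I_n) w => xi (t i.+1) w - xi (t i) w)%R.

Definition stationary_increments (xi : R -> {RV P >-> R}) : Prop :=
  forall s t : R, (0 <= s)%R -> (0 <= t)%R ->
    forall A : set R, measurable A ->
      P [set w | A (xi (s + t) w - xi s w)%R] = P [set w | A (xi t w)].

(* The time set is [0, +oo[; the values at negative times are irrelevant.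
   Left limits exist because the paths are nondecreasing. *)
Definition subordinator (xi : R -> {RV P >-> R}) : Prop :=
  [/\ forall w, xi 0%R w = 0%R,
      forall w s t, (0 <= s)%R -> (s <= t)%R -> (xi s w <= xi t w)%R,
      forall w t, (0 <= t)%R -> xi u w @[u --> t^'+] --> xi t w,
      independent_increments xi
    & stationary_increments xi].

(* Laplace exponent of a subordinator with drift b and Levy measure Pi
   (Levy-Khintchine formula). *)
Definition laplace_exponent (b : R) (Pi : {measure set R -> \bar R}) (q : R)
    : \bar R :=
  (b * q)%:E + \int[Pi]_(y in `]0%R, +oo[) (1 - expR (- (q * y)))%:E.

Definition has_drift_and_Levy_measure (xi : R -> {RV P >-> R}) (b : R)
    (Pi : {measure set R -> \bar R}) : Prop :=
  concentrated_on `]0%R, +oo[ Pi /\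
  forall t q : R, (0 <= t)%R -> (0 < q)%R ->
    \int[P]_w (expR (- (q * xi t w)))%:E =
    expeR (- (t%:E * laplace_exponent b Pi q)).

End subordinator.

Definition image_Levy_measure (R : realType)
    (B Pi : {measure set R -> \bar R}) : Prop :=
  forall g : R -> R, measurable_fun (`]0%R, +oo[ : set R) g ->
    (forall y, (0 < y)%R -> (0 <= g y)%R) ->
    \int[Pi]_(y in `]0%R, +oo[) (g y)%:E =
    \int[B]_(x in `]0%R, 1%R[) (g (- ln x) * x)%:E.

(* The infimum of the empty set is +oo in \bar R. *)
Definition time_change (R : realType) (alpha : R) (path : R -> R) (s : R)
    : \bar R :=
  ereal_inf [set u%:E | u in [set u : R | (0 <= u)%R /\
    s%:E < \int[lebesgue_measure]_(r in `[0%R, u]) (expR (alpha * path r))%:E]].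

(* exp (- xi_u), with exp (- xi_oo) = 0. *)
Definition exp_opp_at (R : realType) (path : R -> R) (u : \bar R) : R :=
  if u is v%:E then expR (- path v) else 0%R.

(* mu t, t >= 0, is the solution started from mu0 that is driven by xi. *)
Definition constructed_solution (d : measure_display) (T : measurableType d)
    (R : realType) (P : probability T R) (alpha : R) (xi : R -> {RV P >-> R})
    (mu0 : {measure set R -> \bar R}) (mu : R -> {measure set R -> \bar R})
    : Prop :=
  forall t : R, (0 <= t)%R ->
    concentrated_on `]0%R, +oo[ (mu t) /\
    forall f : R -> R, measurable_fun (`[0%R, +oo[ : set R) f ->
      (forall x, (0 <= x)%R -> (0 <= f x)%R) -> f 0%R = 0%R ->
      \int[mu t]_(x in `]0%R, +oo[) (f x * x)%:E =
      \int[mu0]_(x in `]0%R, +oo[)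
        ((\int[P]_w (f (x * exp_opp_at (xi ^~ w)
            (time_change alpha (xi ^~ w) (x `^ alpha * t))))%:E) * x%:E).

Definition density_near_pinfty (R : realType) (mu : {measure set R -> \bar R})
    (u : R -> R) : Prop :=
  exists a : R,
    [/\ measurable_fun (`]a, +oo[ : set R) u,
        forall x, (a < x)%R -> (0 <= u x)%R
      & forall A : set R, measurable A -> A `<=` `]a, +oo[ ->
          mu A = \int[lebesgue_measure]_(x in A) (u x)%:E].

Definition equivalent_at_pinfty (R : realType) (f g : R -> R) : Prop :=
  (f x / g x)%R @[x --> +oo%R] --> (1 : R)%R.

(* Main.v *)
(* Idea. Let I be the total clock, the integral over [0, +oo[ of
   exp (alpha xi_r), and phi s = P(s < I). A fragment that starts at x has not
   vanished at time t iff x^alpha t < I, so m(t) is the mu0-integral of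
   x phi(x^alpha t), and the total mass of mubar is phi.
   By the change of variables u = x^alpha t, a density exactly C x^-gamma on
   ]0, +oo[ would contribute exactly C' t^((gamma - 2) / alpha). Small x
   contribute a lower order, and K is finite, because phi decays faster than
   any power: if I > s, then exp (alpha xi_k) exceeds a constant multiple of
   s exp (- c k) for some integer k, and the exponential moments of xi_k given
   by the Levy-Khintchine formula make the union bound O(s^-q).
   This avoids both the joint measurability of xi and the law of I: integrals
   of possibly non-measurable indicators are only compared monotonically. *)
Require Import Defs.
From HB Require Import structures.
From mathcomp Require Import all_boot all_order all_algebra.
From mathcomp Require Import all_classical all_reals all_analysis.
From mathcomp Require Import measurable_realfun ring lra.
Import Order.TTheory GRing.Theory Num.Theory.
Import numFieldNormedType.Exports.
Local Open Scope classical_set_scope.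
Local Open Scope ring_scope.

(** * Measures with a density *)

Section measure_with_density.
Local Open Scope ereal_scope.
Context {d : measure_display} {T : measurableType d} {R : realType}.
Context (mu : {measure set T -> \bar R}) {f : T -> R}.
Context (mf : measurable_fun [set: T] f) (f_ge0 : forall x, (0 <= f x)%R).

(** The two proofs do not enter the value; they are arguments so that the measure structure declared
    below can be inferred from the term. *)
Definition mdensity of measurable_fun [set: T] f & (forall x, (0 <= f x)%R) :=
  fun A : set T => \int[mu]_(x in A) (f x)%:E.

Local Notation nu := (mdensity mf f_ge0).

Let mdensity0 : nu set0 = 0.
Proof. exact: integral_set0. Qed.

Let mdensity_ge0 A : 0 <= nu A.
Proof. by apply: integral_ge0 => x _; rewrite lee_fin. Qed.

Let mfE : measurable_fun [set: T] (EFin \o f).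
Proof. exact/measurable_EFinP. Qed.

Let mdensity_sigma_additive : semi_sigma_additive nu.
Proof. exact: semi_sigma_additive_nng_induced. Qed.

HB.instance Definition _ := isMeasure.Build _ _ _ nu
  mdensity0 mdensity_ge0 mdensity_sigma_additive.

Import HBNNSimple.

(** Both sides are linear in [h], and for the indicator of a level set each is the integral of [f]
    over its intersection with [D]. *)
Lemma integral_mdensity_nnsfun (D : set T) (h : {nnsfun T >-> R}) :
  measurable D ->
  \int[nu]_(x in D) (h x)%:E = \int[mu]_(x in D) ((h x)%:E * (f x)%:E).
Proof.
move=> mD.
have mh y : measurable (h @^-1` [set y]) by exact: measurable_sfunP.
have mhy y : measurable_fun D (fun x => (y * \1_(h @^-1` [set y]) x)%:E).
  by apply/measurable_EFinP/measurable_funTS; exact: measurable_funM.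
have hE x : (h x)%:E = \sum_(y \in range h) (y * \1_(h @^-1` [set y]) x)%:E.
  by rewrite {1}fimfunE -fsumEFin.
pose s x := \sum_(y \in range h) (y * \1_(h @^-1` [set y]) x)%:E.
transitivity (\int[nu]_(x in D) s x).
  by apply: eq_integral => x _; exact: hE.
transitivity (\int[mu]_(x in D) (\sum_(y \in range h)
    ((y * \1_(h @^-1` [set y]) x)%:E * (f x)%:E))); last first.
  apply: eq_integral => x _; rewrite -ge0_mule_fsuml ?hE// => y.
  exact: nnfun_muleindic_ge0.
rewrite ge0_integral_fsum//; last by move=> y x _; exact: nnfun_muleindic_ge0.
rewrite ge0_integral_fsum//; last 2 first.
- by move=> y; apply: emeasurable_funM => //; exact: measurable_funTS.
- by move=> y x _; rewrite mule_ge0 ?nnfun_muleindic_ge0 ?lee_fin.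
apply: eq_fsbigr => y; rewrite inE => -[z _ <-].
under eq_integral do rewrite EFinM.
under [RHS]eq_integral do rewrite EFinM -muleA.
have hz0 : (0 <= h z)%R by exact: fun_ge0.
have m1 : measurable_fun D (fun x => (\1_(h @^-1` [set h z]) x : R)%:E).
  by apply/measurable_EFinP/measurable_funTS; exact: measurable_indic.
rewrite ge0_integralZl ?lee_fin//.
rewrite ge0_integralZl ?lee_fin//; last 2 first.
- by apply: emeasurable_funM => //; exact: measurable_funTS.
- by move=> x _; rewrite mule_ge0 ?lee_fin.
congr (_ * _); rewrite integral_indic// /nu setIC.
rewrite /= /mdensity integral_mkcondr.
apply: eq_integral => x _; rewrite patchE indicE.
by case: ifPn => _; rewrite ?mul1e ?mul0e.
Qed.

(** Monotone convergence on both sides, along simple functions increasing to [g]. *)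
Lemma ge0_integral_mdensity (D : set T) (g : T -> \bar R) :
  measurable D -> measurable_fun D g -> (forall x, D x -> 0 <= g x) ->
  \int[nu]_(x in D) g x = \int[mu]_(x in D) (g x * (f x)%:E).
Proof.
move=> mD mg g0; pose h := nnsfun_approx mD mg.
have h_nd x : {homo (fun n => h n x) : m n / (m <= n)%N >-> (m <= n)%R}.
  by move=> m n mn; exact/lefP/nd_nnsfun_approx.
have hg x : D x -> (h n x)%:E @[n --> \oo] --> g x.
  by move=> Dx; exact: cvg_nnsfun_approx.
have mh n : measurable_fun D (EFin \o h n).
  by apply/measurable_EFinP; exact: measurable_funTS.
transitivity (limn (fun n => \int[nu]_(x in D) (h n x)%:E)).
  rewrite -monotone_convergence//; last 2 first.
  - by move=> n x _; rewrite lee_fin.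
  - by move=> x _ m n mn; rewrite lee_fin h_nd.
  by apply: eq_integral => x /[!inE] Dx; exact/esym/cvg_lim/hg.
under eq_fun do rewrite integral_mdensity_nnsfun//.
rewrite -monotone_convergence//; last 3 first.
- by move=> n; apply: emeasurable_funM; [exact: mh|exact: measurable_funTS].
- by move=> n x _; rewrite mule_ge0 ?lee_fin.
- by move=> x _ m n mn; rewrite lee_wpmul2r ?lee_fin// h_nd.
apply: eq_integral => x /[!inE] Dx; apply/cvg_lim => //.
by apply: cvgeZr => //; exact: hg.
Qed.

End measure_with_density.

(** * The substitution u = x^a t *)

(** Open left rays form a pi-system generating the Borel sets, and the rays []-oo, n[], of finite
    measure, exhaust the line. *)
Lemma measure_eq_rays {R : realType}
    {m1 m2 : {measure set (measurableTypeR R) -> \bar R}} :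
  (forall b, m1 `]-oo, b[%classic = m2 `]-oo, b[%classic) ->
  (forall b, m1 `]-oo, b[%classic < +oo)%E ->
  forall A : set R, measurable A -> m1 A = m2 A.
Proof.
move=> m12 m1oo A mA.
apply: (@measure_unique _ R (measurableTypeR R) (@RGenInftyO.G R)
  (fun n => `]-oo, n%:R[%classic)) => //.
- exact: RGenInftyO.measurableE.
- move=> _ _ [x ->] [y ->]; exists (Num.min x y).
  by apply/seteqP; split => z /=; rewrite !in_itv/= lt_min => /andP.
- by move=> n; exists n%:R.
- apply/seteqP; split => // x _; exists (Num.truncn `|x|).+1 => //.
  by rewrite /= in_itv/= (le_lt_trans (ler_norm x))// truncnS_gt.
- by move=> _ [b ->].
Qed.

Section powR_substitution.
Context {R : realType}.
Implicit Types a c t x y : R.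
Local Notation leb := (@lebesgue_measure R).

Lemma lt0_ltr_powR {a x y : R} :
  a < 0 -> 0 < x -> x < y -> y `^ a < x `^ a.
Proof.
move=> a0 x0 xy; have y0 := lt_trans x0 xy.
rewrite -[a]opprK !(powRN _ (- a)) ltf_pV2 ?posrE ?powR_gt0//.
by rewrite gt0_ltr_powR ?oppr_gt0// nnegrE ltW.
Qed.

Lemma lt0_ler_powR {a x y : R} :
  a < 0 -> 0 < x -> x <= y -> y `^ a <= x `^ a.
Proof.
move=> a0 x0; rewrite le_eqVlt => /predU1P[->//|xy].
exact/ltW/lt0_ltr_powR.
Qed.

Lemma powRVK {a x : R} : a != 0 -> 0 <= x -> (x `^ a^-1) `^ a = x.
Proof. by move=> a0 x0; rewrite -powRrM mulVf// powRr1. Qed.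

Lemma cvg_powRy a : a < 0 -> x `^ a @[x --> +oo] --> 0.
Proof.
move=> a0; apply/cvgrPdist_lt => e e0; near=> x.
have e1 : 0 < e `^ a^-1 by rewrite powR_gt0.
rewrite sub0r normrN ger0_norm ?powR_ge0//.
rewrite -[ltRHS](@powRVK a e) ?lt_eqF ?(ltW e0)//.
by rewrite lt0_ltr_powR.
Unshelve. all: by end_near. Qed.

(** A primitive is -x^a, which vanishes at infinity because a < 0. *)
Lemma integral_powR_tail a c : a < 0 -> 0 < c ->
  (\int[leb]_(x in `[c, +oo[) (`|a| * x `^ (a - 1))%:E
   = (c `^ a)%:E)%E.
Proof.
move=> a0 c0.
have dF x : c <= x -> derivable (fun x : R => - x `^ a) x 1.
  move=> cx; apply: derivableN; apply: derivable_powR.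
  by rewrite in_itv/= andbT (lt_le_trans c0).
have cF x b : c <= x -> {for x, continuous (fun x : R => x `^ b)}.
  move=> cx; apply: differentiable_continuous; apply/derivable1_diffP.
  by apply: derivable_powR; rewrite in_itv/= andbT (lt_le_trans c0).
rewrite (@ge0_continuous_FTC2y R (fun x : R => `|a| * x `^ (a - 1))
  (fun x : R => - x `^ a) c 0).
- by rewrite sub0e EFinN oppeK.
- by move=> x _; rewrite mulr_ge0 ?powR_ge0.
- apply: continuous_in_subspaceT => x; rewrite inE/= in_itv/= andbT => cx.
  by apply: cvgM; [exact: cvg_cst|exact: cF].
- by rewrite -oppr0; apply: cvgN; exact: cvg_powRy.
- by move=> x /ltW /dF.
- apply: cvg_at_right_filter.
  by apply: cvgN; exact: cF.
- move=> x; rewrite in_itv/= andbT => cx.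
  rewrite derive1E deriveN; last first.
    by apply: derivable_powR; rewrite in_itv/= andbT (lt_trans c0).
  rewrite -derive1E powR_derive1 ?in_itv/= ?andbT ?(lt_trans c0)//.
  by rewrite ltr0_norm// mulNr.
Qed.

(** The map x -> x^a t carries |a| t x^(a-1) dx on []0, +oo[] to Lebesgue measure on []0, +oo[]. By
    uniqueness this is checked on rays only; since the map decreases, their preimages are right rays
    or empty. *)
Lemma ge0_integral_powR_subst a t (G : R -> \bar R) :
  a < 0 -> 0 < t -> measurable_fun (`]0%R, +oo[ : set R) G ->
  (forall u, 0 < u -> (0 <= G u)%E) ->
  (\int[leb]_(u in `]0%R, +oo[) G u =
   \int[leb]_(x in `]0%R, +oo[)
     (G (x `^ a * t)%R * (`|a| * t * x `^ (a - 1))%:E))%E.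
Proof.
move=> a0 t0 mG G0.
set D : set R := `]0%R, +oo[%classic.
pose h (x : R) : R := x `^ a * t.
(* The indicator discards x <= 0, where [powR] takes default values. *)
pose w (x : R) : R := \1_D x * (`|a| * t * x `^ (a - 1)).
have mD : measurable D by exact: measurable_itv.
have w0 x : 0 <= w x by rewrite mulr_ge0// mulr_ge0 ?powR_ge0// mulr_ge0// ltW.
have mw : measurable_fun [set: R] w.
  by apply: measurable_funM => //; exact: measurable_funM.
have mh : measurable_fun [set: R] h.
  exact: measurable_funM.
have h_gt0 x : 0 < x -> 0 < h x by move=> x0; rewrite mulr_gt0 ?powR_gt0.
pose m1 := mrestr leb mD.
pose nu := mdensity leb mw w0.
pose m2 := pushforward nu (h : _ -> measurableTypeR R).
have wE (A : set R) (g : R -> \bar R) :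
    (\int[leb]_(x in A) (g x * (w x)%:E) =
     \int[leb]_(x in A `&` D) (g x * (`|a| * t * x `^ (a - 1))%:E))%E.
  rewrite integral_mkcondr; apply: eq_integral => x _.
  by rewrite /w patchE indicE; case: ifPn; rewrite ?mul1r ?mul0r ?mule0.
have m12_ray b : m1 `]-oo, b[%classic = m2 `]-oo, b[%classic.
  transitivity (\int[leb]_(x in h @^-1` `]-oo, b[ `&` D)
      (`|a| * t * x `^ (a - 1))%:E)%E; last first.
    have := wE (h @^-1` `]-oo, b[) (cst 1%E).
    under eq_integral do rewrite mul1e.
    by under [X in _ = X -> _]eq_integral do rewrite mul1e.
  rewrite /m1 /mrestr.
  have [b0|b0] := leP b 0.
    have -> : `]-oo, b[%classic `&` D = set0.
      apply/seteqP; split => x //=; rewrite /D/= !in_itv/= andbT => -[xb x0].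
      by have := lt_trans x0 (lt_le_trans xb b0); rewrite ltxx.
    have -> : h @^-1` `]-oo, b[ `&` D = set0.
      apply/seteqP; split => x //=; rewrite /D/= !in_itv/= andbT => -[xb x0].
      by have := lt_trans (h_gt0 _ x0) (lt_le_trans xb b0); rewrite ltxx.
    by rewrite measure0 integral_set0.
  have -> : `]-oo, b[%classic `&` D = `]0, b[%classic.
    apply/seteqP; split => x /=; rewrite /D/= !in_itv/= andbT.
      by move=> [-> ->].
    by move=> /andP[-> ->].
  (* The point that [h] sends to [b]. *)
  pose c : R := (b / t) `^ a^-1.
  have c0 : 0 < c by rewrite powR_gt0// divr_gt0.
  have ca : c `^ a = b / t by rewrite powRVK ?lt_eqF// divr_ge0// ltW.
  have -> : h @^-1` `]-oo, b[ `&` D = `]c, +oo[%classic.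
    apply/seteqP; split => x /=; rewrite /D/= !in_itv/= !andbT.
      move=> [hb x0]; rewrite ltNge; apply/negP => /(lt0_ler_powR a0 x0).
      by rewrite ca ler_pdivrMr// leNgt hb.
    move=> cx; split; last exact: lt_trans cx.
    by rewrite /h -ltr_pdivlMr// -ca lt0_ltr_powR.
  rewrite lebesgue_measure_itv/= lte_fin b0 sube0.
  rewrite integral_itv_obnd_cbnd; last first.
    apply/measurable_EFinP; apply: measurable_funM => //.
    by apply: measurable_funTS; exact: measurable_powR.
  (* Once [t] is taken out, the integral is c^a, and t c^a = b is the length of []0, b[]. *)
  under eq_integral do rewrite mulrAC mulrC EFinM.
  rewrite ge0_integralZl ?lee_fin ?(ltW t0)//.
  - by rewrite integral_powR_tail// ca -EFinM mulrC divfK ?gt_eqF.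
  - apply/measurable_EFinP; apply: measurable_funM => //.
    by apply: measurable_funTS; exact: measurable_powR.
  - by move=> x _; rewrite lee_fin mulr_ge0 ?powR_ge0.
have m12 (A : set R) : measurable A -> m1 A = m2 A.
  rewrite /m1 /m2 /nu => mA; apply: measure_eq_rays => // b.
  rewrite (@le_lt_trans _ _ (leb `]0, b[%classic))//.
    rewrite /= /mrestr; apply: le_measure; rewrite ?inE.
    - exact: measurableI.
    - exact: measurable_itv.
    by move=> x /=; rewrite /D/= !in_itv/= andbT => -[-> ->].
  by rewrite lebesgue_measure_itv/=; case: ifP => // _; rewrite sube0 ltry.
transitivity (\int[m2]_(u in D) G u)%E.
  apply: eq_measure_integral => A mA AD.
  have AE : leb A = m1 A by rewrite /m1 /mrestr (setIidl AD).
  exact: (etrans AE (m12 A mA)).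
rewrite ge0_integral_pushforward//; last first.
  by move=> u; rewrite inE/= /D/= in_itv/= andbT => /G0.
have mhD : measurable (h @^-1` D).
  by rewrite -[X in measurable X]setTI; exact: mh.
rewrite ge0_integral_mdensity//; last 2 first.
- apply: (measurable_comp mD) => //; first by move=> _ [x hx <-].
  exact: measurable_funTS.
- by move=> x /=; rewrite /D/= in_itv/= andbT => /G0.
rewrite wE; congr (integral _ _ _); apply/seteqP; split => [x []//|x Dx].
split => //; move: Dx; rewrite /D/= !in_itv/= !andbT; exact: h_gt0.
Qed.

End powR_substitution.

(** * Survival of a fragment *)

(* Unlike ge0_le_integral, no measurability is required: the integral of a
   nonnegative function is a supremum over simple functions below it. *)
Lemma ge0_le_lower_integral {d : measure_display} {T : measurableType d}
    {R : realType} (mu : {measure set T -> \bar R}) (D : set T)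
    (f g : T -> \bar R) :
  (forall x, D x -> (0 <= f x)%E) -> (forall x, D x -> (f x <= g x)%E) ->
  (\int[mu]_(x in D) f x <= \int[mu]_(x in D) g x)%E.
Proof.
move=> f0 fg; have g0 x : D x -> (0 <= g x)%E.
  by move=> Dx; exact: le_trans (f0 x Dx) (fg x Dx).
rewrite !ge0_integralE//; apply: le_ereal_sup => _ [h hf <-].
exists h => // x; apply: le_trans (hf x) _; rewrite !patchE.
by case: ifPn => // /[!inE] /fg.
Qed.

Section path_functional.
Context {R : realType}.
Implicit Types (a s c : R) (path : R -> R).
Local Notation leb := (@lebesgue_measure R).

(** This is s < I for the total clock I of the path; equivalently, the set whose infimum is
    [time_change] is nonempty. *)
Definition reaches a path s : Prop :=
  exists2 u, 0 <= u &
    (s%:E < \int[leb]_(r in `[0%R, u]) (expR (a * path r))%:E)%E.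

Lemma reaches_le {a path} s {s'} :
  s <= s' -> reaches a path s' -> reaches a path s.
Proof.
by move=> ss' [u u0 su]; exists u => //; rewrite (le_lt_trans _ su)// lee_fin.
Qed.

(** If the set is empty, its infimum is +oo, where the exponential is 0 by convention; otherwise the
    infimum is a real number and the exponential is positive. *)
Lemma indic_exp_opp_at_time_change a path s :
  \1_(`]0, +oo[%classic : set R) (exp_opp_at path (time_change a path s)) =
  (`[< reaches a path s >])%:R :> R.
Proof.
have in01 (v : R) : \1_(`]0, +oo[%classic : set R) v = (0 < v)%R%:R :> R.
  by rewrite indicE mem_setE in_itv/= andbT.
rewrite in01; congr ((nat_of_bool _)%:R); apply/idP/asboolP.
  rewrite /time_change; case E : (ereal_inf _) => [v| |]; rewrite /= ?ltxx//.
  move=> _; apply: contrapT => nr; move: E.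
  rewrite (_ : [set _ | _ in _] = set0) ?ereal_inf0//.
  by apply/seteqP; split => // y [u [u0 su] _]; apply: nr; exists u.
move=> [u u0 su]; rewrite /time_change.
set X := [set _ | _ in _].
have Xu : X u%:E by exists u.
have : (ereal_inf X <= u%:E)%E by exact: ereal_inf_lbound.
(* The lower bound excludes the value -oo, at which [exp_opp_at] would also be 0. *)
have : (0 <= ereal_inf X)%E.
  by apply: le_ereal_inf_tmp => _ [v [v0 _] <-]; rewrite lee_fin.
by case: (ereal_inf X) => //= v _ _; exact: expR_gt0.
Qed.

(* Otherwise, by monotonicity between integers, exp (a path x) is at most
   s c exp (- c x) for all x >= 0, a function whose integral is s. *)
Lemma reaches_nat {a path s c} : a < 0 -> 0 < s -> 0 < c ->
  (forall x y, 0 <= x -> x <= y -> path x <= path y) ->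
  reaches a path s ->
  exists k : nat, s * (c * expR (- c)) < expR (a * path k%:R + c * k%:R).
Proof.
move=> a0 s0 c0 nd_path [u u0]; rewrite ltNge => /negP su.
apply: contrapT => /forallNP hk; apply: su.
(* With k the integer part of x, monotonicity passes from x to k; the factor exp (- c) pays for x <
   k + 1. *)
have le1 x : 0 <= x -> expR (a * path x) <= s * (c * expR (- c * x)).
  move=> x0; pose k := Num.truncn x.
  have /andP[kx xk] := truncn_itv x0.
  have /negP := hk k.
  rewrite -leNgt expRD -ler_pdivlMr ?expR_gt0// -expRN => hk1.
  apply: (@le_trans _ _ (expR (a * path k%:R))).
    by rewrite ler_expR ler_nM2l// nd_path.
  apply: (le_trans hk1); rewrite -!mulrA ler_pM2l// ler_pM2l// -expRD ler_expR.
  rewrite mulNr -opprD lerN2 -[X in X + _]mulr1 -mulrDr ler_pM2l//.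
  by rewrite addrC natr1 ltW.
(* [s] times the density of the exponential law of rate [c], hence of integral [s]. *)
pose g (x : R) : \bar R := (s%:E * (exponential_pdf c x)%:E)%E.
apply: (@le_trans _ _ (\int[leb]_(r in `[0%R, u]) g r)%E).
  apply: ge0_le_lower_integral => x; rewrite /= in_itv/= => /andP[x0 xu].
    by rewrite lee_fin expR_ge0.
  by rewrite /g -EFinM lee_fin exponential_pdfE// le1.
apply: (@le_trans _ _ (\int[leb]_r g r)%E).
  apply: ge0_subset_integral => //.
    by apply: emeasurable_funM => //; apply/measurable_EFinP;
      exact: measurable_exponential_pdf.
  move=> x _; rewrite /g -EFinM lee_fin mulr_ge0 ?exponential_pdf_ge0//;
    exact: ltW.
rewrite ge0_integralZl ?lee_fin ?(ltW s0)//.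
- by rewrite integral_exponential_pdf// mule1.
- by apply/measurable_EFinP; exact: measurable_exponential_pdf.
- by move=> x _; rewrite lee_fin exponential_pdf_ge0// ltW.
Qed.

End path_functional.

Section survival.
Context {d : measure_display} {T : measurableType d} {R : realType}.
Context (P : probability T R) (a : R) (xi : R -> {RV P >-> R}).
Implicit Types s : R.

(** This is P(s < I), written as the integral that occurs in [constructed_solution] when f is the
    indicator of []0, +oo[]. *)
Definition survival s : \bar R :=
  (\int[P]_w (`[< reaches a (xi ^~ w) s >]%:R)%:E)%E.

Lemma survival_ge0 s : (0 <= survival s)%E.
Proof. by apply: integral_ge0 => w _; rewrite lee_fin. Qed.

Lemma survival_le s s' : s <= s' -> (survival s' <= survival s)%E.
Proof.
move=> ss'; apply: ge0_le_lower_integral => w _; first by rewrite lee_fin.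
rewrite lee_fin ler_nat; case: asboolP => // r.
by rewrite asboolT//; exact: reaches_le r.
Qed.

Lemma survival_le1 s : (survival s <= 1)%E.
Proof.
rewrite -(@probability_setT _ _ _ P) -[leRHS]mul1e -integral_cst//.
apply: ge0_le_lower_integral => w _ /=; first by rewrite lee_fin.
by rewrite lee_fin; case: asboolP.
Qed.

Lemma survivalE x s : 0 < x ->
  (\int[P]_w (\1_(`]0%R, +oo[%classic : set R)
     (x * exp_opp_at (xi ^~ w) (time_change a (xi ^~ w) s))%R)%:E)%E =
  survival s.
Proof.
move=> x0; apply: eq_integral => w _.
rewrite -indic_exp_opp_at_time_change !indicE !mem_setE !in_itv/= !andbT.
by rewrite pmulr_rgt0.
Qed.

Hypothesis nd_xi : forall w s t, 0 <= s -> s <= t -> xi s w <= xi t w.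
Hypothesis a0 : a < 0.

(** A union bound with exponential moments: on s < I some k satisfies s b < exp (a xi_k + c k), so
    the k-th term [f k], which is the q-th power of the ratio of the two sides, is at least 1. *)
Lemma survival_tail (q l : R) : 0 < q -> 0 < l ->
  (forall k : nat, (\int[P]_w (expR (- (q * `|a| * xi k%:R w)))%:E <=
    (expR (- (k%:R * l)))%:E)%E) ->
  exists2 M, 0 <= M & forall s, 0 < s -> (survival s <= (M * s `^ (- q))%:E)%E.
Proof.
move=> q0 l0 laplace.
(* With this [c], the factor exp (q c k) is exp (k l / 2), which uses up half of the decay exp (- k
   l) and leaves the geometric ratio [z]. *)
pose c := l / (2 * q); have c0 : 0 < c by rewrite divr_gt0// mulr_gt0.
pose b := c * expR (- c); have b0 : 0 < b by rewrite mulr_gt0// expR_gt0.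
pose z := expR (- (l / 2)).
have z0 : 0 < z by exact: expR_gt0.
have z1 : z < 1 by rewrite -expR0 ltr_expR oppr_lt0 divr_gt0.
exists (b `^ (- q) / (1 - z)).
  by rewrite divr_ge0 ?powR_ge0// subr_ge0 ltW.
move=> s s0.
pose A := (s * b) `^ (- q).
have A0 : 0 < A by rewrite powR_gt0// mulr_gt0.
pose f (k : nat) (w : T) : \bar R :=
  ((A * expR (k%:R * (l / 2)))%:E * (expR (- (q * `|a| * xi k%:R w)))%:E)%E.
have Ak0 k : 0 <= A * expR (k%:R * (l / 2)).
  by rewrite mulr_ge0 ?expR_ge0// ltW.
have f0 k w : (0 <= f k w)%E by rewrite mule_ge0 ?lee_fin ?expR_ge0.
have mE k : measurable_fun [set: T]
    (fun w => (expR (- (q * `|a| * xi k%:R w)))%:E).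
  apply/measurable_EFinP; apply: measurableT_comp => //.
  apply: measurableT_comp => //; exact: measurable_funM.
have mf k : measurable_fun [set: T] (f k) by exact: emeasurable_funM.
(* The indicator is dominated by a measurable series, which can be integrated term by term. *)
apply: (@le_trans _ _ (\int[P]_w \sum_(k <oo) f k w)%E).
  apply: ge0_le_lower_integral => w _; first by rewrite lee_fin.
  case: asboolP => [r|_]; last exact: nneseries_ge0.
  have [k kP] := reaches_nat a0 s0 c0 (nd_xi w) r.
  apply: (@le_trans _ _ (f k w)); last first.
    apply: le_trans (nneseries_lim_ge k.+1 _) => //.
    by rewrite big_nat_recr//= leeDr// sume_ge0.
  rewrite /f -EFinM lee_fin /= -(mulrA A) -expRD.
  rewrite /A powRN mulrC ler_pdivlMr ?mul1r; last first.
    by rewrite powR_gt0// mulr_gt0.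
  rewrite (@le_trans _ _ (expR (a * xi k%:R w + c * k%:R) `^ q))//.
    by rewrite ge0_ler_powR ?nnegrE ?expR_ge0 ?ltW// mulr_gt0.
  rewrite -expRM ler_expR ltr0_norm// /c.
  by rewrite le_eqVlt; apply/orP; left; apply/eqP; field; rewrite gt_eqF.
rewrite integral_nneseries//.
apply: lime_le; first by apply: is_cvg_nneseries => k _ _; exact: integral_ge0.
apply: nearW => n.
apply: (@le_trans _ _ (\sum_(0 <= k < n) (A * z ^+ k)%:E)%E).
  apply: lee_sum => k _; rewrite ge0_integralZl ?lee_fin//.
  apply: (@le_trans _ _ ((A * expR (k%:R * (l / 2)))%:E
      * (expR (- (k%:R * l)))%:E)%E).
    by rewrite lee_wpmul2l ?lee_fin.
  rewrite -EFinM lee_fin -(mulrA A) -expRD -expRM_natl ler_pM2l// ler_expR.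
  by rewrite le_eqVlt; apply/orP; left; apply/eqP; field.
rewrite sumEFin lee_fin (le_trans (geometric_le_lim n (ltW A0) z0 _))//.
  by rewrite ger0_norm// ltW.
by rewrite /A powRM ?(ltW s0) ?(ltW b0)// [leRHS]mulrC mulrA.
Qed.

(** Since xi_1 is finite, xi_1 <= n has positive probability for some n; on this event the clock at
    time 1 is at least exp (a n). *)
Lemma survival_gt0 : exists2 s, 0 < s & (0 < survival s)%E.
Proof.
have mxi n : measurable [set w | xi 1 w <= n%:R].
  rewrite (_ : [set w | _] = xi 1 @^-1` `]-oo, n%:R]%classic).
    exact: measurable_funPTI.
  by apply/seteqP; split => w /=; rewrite in_itv.
have [n Pn] : exists n : nat, (0 < P [set w | (xi 1 w <= n%:R)%R])%E.
  apply: contrapT => /forallNP P0.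
  have : P.-negligible (\bigcup_n [set w | xi 1 w <= n%:R]).
    apply: negligible_bigcup => n; exists [set w | xi 1 w <= n%:R]; split => //.
    by apply/eqP; rewrite eq_le measure_ge0 andbT leNgt; exact/negP/P0.
  rewrite (_ : \bigcup__ _ = setT); last first.
    apply/seteqP; split => // w _; exists (Num.truncn `|xi 1 w|).+1 => //=.
    by rewrite (le_trans (ler_norm _))// ltW// truncnS_gt.
  move=> /(negligibleP _ measurableT) /(etrans (esym (probability_setT P))).
  by move=> /eqP; rewrite onee_eq0.
(* Halving provides the strict inequality in [reaches]. *)
exists (expR (a * n%:R) / 2); first by rewrite divr_gt0 ?expR_gt0.
apply: lt_le_trans Pn _.
rewrite -[leLHS]mul1e -integral_cst// integral_mkcond.
apply: ge0_le_lower_integral => w _; rewrite patchE.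
  by case: ifPn.
case: ifPn => [/[!inE]/= xn|_]; last by rewrite lee_fin.
rewrite asboolT//; exists 1 => //.
apply: (@lt_le_trans _ _ (\int[@lebesgue_measure R]_(r in `[0%R, 1%R])
    (expR (a * n%:R))%:E)%E).
  rewrite integral_cst//= lebesgue_measure_itv/= lte01 sube0 mule1 lte_fin.
  by rewrite ltr_pdivrMr// ltr_pMr ?expR_gt0// ltr1n.
apply: ge0_le_lower_integral => r /=; rewrite in_itv/= => /andP[r0 r1].
  by rewrite lee_fin expR_ge0.
by rewrite lee_fin ler_expR ler_nM2l// (le_trans _ xn)// nd_xi.
Qed.

End survival.

(** * Decay of the survival function, from the Levy-Khintchine formula *)

Lemma integral_gt0 {d : measure_display} {T : measurableType d} {R : realType}
    (mu : {measure set T -> \bar R}) (D : set T) (f : T -> R) :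
  measurable D -> measurable_fun D f -> (forall x, D x -> 0 < f x) ->
  (0 < mu D)%E -> (0 < \int[mu]_(x in D) (f x)%:E)%E.
Proof.
move=> mD mf f0 D0; rewrite lt0e; apply/andP; split; last first.
  by apply: integral_ge0 => x /f0 /ltW; rewrite lee_fin.
(* A zero integral forces f = 0 almost everywhere on [D], where f is positive everywhere. *)
apply/eqP => int0; have : mu.-negligible D.
  have /ae_eq_integral_abs : (\int[mu]_(x in D) `|(f x)%:E| = 0)%E.
    rewrite -[RHS]int0; apply: eq_integral => x /[!inE] /f0 x0.
    by rewrite abse_EFin gtr0_norm.
  move=> /(_ mD)[]; first exact/measurable_EFinP.
  move=> N [mN N0 sub]; exists N; split => // x Dx.
  by apply: sub => /= /(_ Dx) [] /eqP; rewrite gt_eqF// f0.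
by move=> /(negligibleP _ mD) D_0; move: D0; rewrite D_0 ltxx.
Qed.

(** By the image formula the exponent is the [B]-integral of (1 - x^q) x, which is positive on []0,
    1[]. *)
Lemma laplace_exponent_gt0 {R : realType} (B Pi : {measure set R -> \bar R})
    (q : R) :
  (0 < B `]0%R, 1%R[%classic)%E -> image_Levy_measure B Pi -> 0 < q ->
  (0 < laplace_exponent 0 Pi q)%E.
Proof.
move=> B0 BPi q0; rewrite /laplace_exponent mul0r add0e.
have mE (D : set R) (h : R -> R) : measurable D -> measurable_fun [set: R] h ->
    measurable_fun D (fun y => 1 - expR (- (q * h y))).
  move=> mD mh; apply: measurable_funTS; apply: measurable_funB => //.
  apply: measurableT_comp => //; apply: measurableT_comp => //.
  exact: measurable_funM.
rewrite (BPi (fun y => 1 - expR (- (q * y)))); last 2 first.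
- exact: (mE _ id).
- by move=> y y0; rewrite subr_ge0 -expR0 ler_expR oppr_le0 mulr_ge0// ltW.
have f_gt0 x : `]0, 1[%classic x -> 0 < (1 - expR (- (q * - ln x))) * x.
  rewrite /= in_itv/= => /andP[x0 x1].
  rewrite mulr_gt0// subr_gt0 -expR0 ltr_expR oppr_lt0 mulr_gt0// oppr_gt0.
  by rewrite ln_lt0// x0.
apply: integral_gt0 => //; apply: measurable_funM => //.
apply: (mE _ (fun x => - ln x)) => //.
by apply: measurableT_comp => //; exact: measurable_ln.
Qed.

Lemma subordinator_survival_tail {d : measure_display} {T : measurableType d}
    {R : realType} (P : probability T R) (alpha : R) (xi : R -> {RV P >-> R})
    (B Pi : {measure set R -> \bar R}) (q : R) :
  alpha < 0 -> (0 < B `]0%R, 1%R[%classic)%E -> image_Levy_measure B Pi ->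
  subordinator xi -> has_drift_and_Levy_measure xi 0 Pi -> 0 < q ->
  exists2 M, 0 <= M &
    forall s, 0 < s -> (survival P alpha xi s <= (M * s `^ (- q))%:E)%E.
Proof.
move=> a0 B0 BPi [_ nd_xi _ _ _] [_ levy] q0.
have qa0 : 0 < q * `|alpha| by rewrite mulr_gt0// normr_gt0 lt_eqF.
have L0 := laplace_exponent_gt0 _ _ _ B0 BPi qa0.
(* A positive real lower bound suffices; it is 1 if the exponent is +oo. *)
have [l l0 lL] : exists2 l : R, 0 < l &
    (l%:E <= laplace_exponent 0 Pi (q * `|alpha|))%E.
  move: L0; case: laplace_exponent => [l l0| _|//]; first by exists l.
  by exists 1 => //; rewrite leey.
apply: (survival_tail P alpha xi nd_xi a0 _ l) => // k.
rewrite levy//.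
have -> : (expR (- (k%:R * l)))%:E = expeR (- (k%:R%:E * l%:E)) by [].
by rewrite lee_expeR leeN2 lee_wpmul2l ?lee_fin.
Qed.

(** * Integration against the density of the initial measure *)

Lemma integral_density {R : realType} (mu : {measure set R -> \bar R})
    (u : R -> R) (a : R) (D : set R) (g : R -> \bar R) :
  measurable_fun (`]a, +oo[ : set R) u -> (forall x, a < x -> 0 <= u x) ->
  (forall A : set R, measurable A -> A `<=` `]a, +oo[ ->
     mu A = \int[lebesgue_measure]_(x in A) (u x)%:E)%E ->
  measurable D -> D `<=` `]a, +oo[ -> measurable_fun D g ->
  (forall x, D x -> (0 <= g x)%E) ->
  (\int[mu]_(x in D) g x =
   \int[@lebesgue_measure R]_(x in D) (g x * (u x)%:E))%E.
Proof.
move=> mfu u_ge0 muE mD Da mg g0.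
(* The function u is controlled on []a, +oo[] only; its extension by 0 is a density on the whole
   line. *)
pose v : R -> R := u \_ `]a, +oo[.
have vE x : D x -> v x = u x by move=> /Da xa; rewrite /v patchE mem_set.
have mv : measurable_fun [set: R] v.
  by apply/(measurable_restrictT _ _).1 => //; exact: measurable_itv.
have v0 x : 0 <= v x.
  rewrite /v patchE; case: ifPn => // /[!inE]/=.
  by rewrite in_itv/= andbT => /u_ge0.
have mid :
    measurable_fun [set: measurableTypeR R] (id : measurableTypeR R -> R).
  by move=> _ B mB; rewrite setTI.
(* The identity transports lebesgue_measure, which lives on measurableTypeR R,
   to a measure on R. *)
transitivity (\int[pushforward (mdensity (@lebesgue_measure R) mv v0)
    (id : measurableTypeR R -> R)]_(x in D) g x)%E.
  apply: eq_measure_integral => A mA AD; rewrite muE//; last first.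
    exact: subset_trans Da.
  by apply: eq_integral => x /[!inE] /AD /vE ->.
rewrite ge0_integral_pushforward//; last by move=> x /[!inE] /g0.
rewrite ge0_integral_mdensity//.
by apply: eq_integral => x /[!inE] /vE ->.
Qed.

Lemma itvoy_split {R : realType} (A : R) : 0 < A ->
  `]0, +oo[%classic = `]0, A]%classic `|` `]A, +oo[%classic :> set R.
Proof. by move=> A0; rewrite -itv_bndbnd_setU// bnd_simp ltW. Qed.

Lemma disjoint_itvoc_oy {R : realType} (a b : R) :
  [disjoint (`]a, b]%classic : set R) & `]b, +oo[%classic].
Proof.
apply/disj_setPS => x [] /=; rewrite !in_itv/= andbT => /andP[_ xb].
by rewrite ltNge xb.
Qed.

(** * Asymptotics *)

Section power_tail.
Context {R : realType} (alpha gamma M : R) (phi : R -> R).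
Hypothesis alpha0 : alpha < 0.
Hypothesis gamma2 : 2 < gamma.
Hypothesis M0 : 0 <= M.
Hypothesis phi_ge0 : forall s, 0 <= phi s.
Hypothesis phi_le1 : forall s, phi s <= 1.
Hypothesis phi_le : forall s s', s <= s' -> phi s' <= phi s.
Hypothesis phi_tail :
  forall s, 0 < s -> phi s <= M * s `^ (- ((1 - gamma) / alpha)).
Implicit Types (x t A : R).
Local Notation leb := (@lebesgue_measure R).
Local Notation p := ((2 - gamma) / alpha).
Local Notation q := ((1 - gamma) / alpha).

Let p0 : 0 < p.
Proof. by rewrite ltr_ndivlMr// mul0r subr_lt0. Qed.

(* The exponent q makes x^alpha t contribute the power x^(gamma - 1), which
   cancels the density x^(1 - gamma) of x mu0. *)
Lemma phi_powR_le x t : 0 < x -> 0 < t ->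
  phi (x `^ alpha * t) <= M * x `^ (gamma - 1) * t `^ (- q).
Proof.
move=> x0 t0; apply: le_trans (phi_tail _ _) _.
  by rewrite mulr_gt0 ?powR_gt0.
rewrite powRM ?powR_ge0 ?(ltW t0)// -powRrM mulrA.
by rewrite (_ : alpha * - q = gamma - 1)//; field; rewrite lt_eqF.
Qed.

Lemma measurable_phi (D : set R) : measurable D -> measurable_fun D phi.
Proof.
by move=> mD; apply: nonincreasing_measurable => // x y _ _; exact: phi_le.
Qed.

Lemma measurable_phi_powR (D : set R) t : measurable D ->
  measurable_fun D (fun x => phi (x `^ alpha * t)).
Proof.
move=> mD; apply: measurable_funTS.
apply: (measurableT_comp (measurable_phi _ measurableT)).
exact: measurable_funM.
Qed.

(** The contribution of the fragments that start in [D], for the initial density x^-gamma. *)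
Let J (D : set R) t :=
  (\int[leb]_(x in D) (phi (x `^ alpha * t) * x `^ (1 - gamma))%:E)%E.

Let mJ (D : set R) t : measurable D ->
  measurable_fun D (fun x => (phi (x `^ alpha * t) * x `^ (1 - gamma))%:E).
Proof.
move=> mD; apply/measurable_EFinP; apply: measurable_funM.
  exact: measurable_phi_powR.
by apply: measurable_funTS; exact: measurable_powR.
Qed.

Let J_ge0 x t : (0 <= (phi (x `^ alpha * t) * x `^ (1 - gamma))%:E)%E.
Proof. by rewrite lee_fin mulr_ge0 ?powR_ge0. Qed.

Definition tail_constant : \bar R :=
  (\int[leb]_(u in `]0%R, +oo[) (phi u * u `^ (p - 1))%:E)%E.
Local Notation K := tail_constant.

(** Under u = x^alpha t, u^(p-1) du becomes |alpha| t^p x^(1-gamma) dx, because alpha p = 2 -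
    gamma. *)
Lemma tail_constantE t : 0 < t ->
  K = ((`|alpha| * t `^ p)%:E * J `]0%R, +oo[ t)%E.
Proof.
move=> t0; rewrite /K (ge0_integral_powR_subst alpha t)//; last 2 first.
- apply/measurable_EFinP; apply: measurable_funM; last first.
    by apply: measurable_funTS; exact: measurable_powR.
  by apply: measurable_phi; exact: measurable_itv.
- by move=> u u0; rewrite lee_fin mulr_ge0 ?powR_ge0.
rewrite /J -ge0_integralZl; last 4 first.
- exact: measurable_itv.
- exact: mJ.
- by move=> x _; exact: J_ge0.
- by rewrite lee_fin mulr_ge0 ?powR_ge0.
apply: eq_integral => x; rewrite inE/= in_itv/= andbT => x0.
rewrite -!EFinM; congr (_%:E).
rewrite powRM ?powR_ge0 ?(ltW t0)// -powRrM.
rewrite -(mulr_powRB1 (ltW t0) p0).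
rewrite (_ : 1 - gamma = alpha * (p - 1) + (alpha - 1)); last first.
  by field; rewrite lt_eqF.
rewrite [X in _ = _ * (_ * X)]powRD; last by rewrite (gt_eqF x0) implybT.
ring.
Qed.

(** By [phi_powR_le] the integrand is at most M t^-q. This is of lower order than t^-p, since p - q
    = 1 / alpha < 0. *)
Lemma J_le A t : 0 < A -> 0 < t -> (J `]0%R, A] t <= (M * t `^ (- q) * A)%:E)%E.
Proof.
move=> A0 t0.
apply: (@le_trans _ _ (\int[leb]_(x in `]0%R, A]) (M * t `^ (- q))%:E)%E).
  apply: ge0_le_lower_integral => x; rewrite /= in_itv/= => /andP[x0 xA].
    exact: J_ge0.
  rewrite lee_fin.
  apply: le_trans (ler_wpM2r (powR_ge0 _ _) (phi_powR_le _ _ x0 t0)) _.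
  have -> : x `^ (1 - gamma) = (x `^ (gamma - 1))^-1 by rewrite -powRN opprB.
  by rewrite (mulrAC M) mulfK// gt_eqF ?powR_gt0.
by rewrite integral_cst//= lebesgue_measure_itv/= lte_fin A0 sube0 EFinM.
Qed.

Lemma J_split A t : 0 < A -> 0 < t ->
  J `]0%R, +oo[ t = (J `]0%R, A] t + J `]A, +oo[ t)%E.
Proof.
move=> A0 t0.
rewrite /J {1}(itvoy_split A)// ge0_integral_setU//=.
- by rewrite -itvoy_split//; exact: mJ.
- exact: disjoint_itvoc_oy.
Qed.

(** Taking t = 1, [J_le] controls []0, 1]], while beyond 1 phi <= 1 and x^(1-gamma) is integrable as
    gamma > 2. *)
Lemma tail_constant_lty : (K < +oo)%E.
Proof.
rewrite (tail_constantE 1)// lte_mul_pinfty ?lee_fin ?mulr_ge0 ?powR_ge0//.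
rewrite (J_split 1)// lte_add_pinfty//.
  by rewrite (le_lt_trans (J_le 1 1 _ _))// ltry.
apply: (@le_lt_trans _ _ (\int[leb]_(x in `[1%R, +oo[) (`|2 - gamma|^-1%:E *
   (`|2 - gamma| * x `^ (2 - gamma - 1))%:E))%E).
  rewrite -integral_itv_obnd_cbnd; last first.
    apply/measurable_EFinP; apply: measurable_funM => //.
    apply: measurable_funM => //.
    by apply: measurable_funTS; exact: measurable_powR.
  apply: ge0_le_lower_integral => x _; first exact: J_ge0.
  rewrite -EFinM lee_fin mulKf ?normr_eq0 ?subr_eq0 ?lt_eqF//.
  by rewrite (_ : 2 - gamma - 1 = 1 - gamma) ?ler_piMl ?powR_ge0//; ring.
rewrite ge0_integralZl//.
- by rewrite integral_powR_tail ?subr_lt0// -EFinM ltry.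
- apply/measurable_EFinP; apply: measurable_funM => //.
  by apply: measurable_funTS; exact: measurable_powR.
- by move=> x _; rewrite lee_fin mulr_ge0 ?powR_ge0.
Qed.

Lemma tail_constant_gt0 s : 0 < s -> 0 < phi s -> (0 < K)%E.
Proof.
move=> s0 phis.
have m1 (D : set R) : measurable D ->
    measurable_fun D (fun u => phi u * u `^ (p - 1)).
  move=> mD; apply: measurable_funM; first exact: measurable_phi.
  by apply: measurable_funTS; exact: measurable_powR.
apply: (@lt_le_trans _ _
  (\int[leb]_(u in `]0%R, s[) (phi u * u `^ (p - 1))%:E)%E).
  apply: integral_gt0 => //; first exact: m1.
    move=> u; rewrite /= in_itv/= => /andP[u0 us].
    by rewrite mulr_gt0 ?powR_gt0// (lt_le_trans phis)// phi_le// ltW.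
  by rewrite /= lebesgue_measure_itv/= lte_fin s0 sube0 lte_fin.
apply: ge0_subset_integral => //.
- by apply/measurable_EFinP; exact: m1.
- by move=> u _; rewrite lee_fin mulr_ge0 ?powR_ge0.
- by move=> u /=; rewrite !in_itv/= andbT => /andP[].
Qed.

(** * Comparison of the initial measure with an exact power density *)

Section initial_measure.
Context (mu0 : {measure set R -> \bar R}) (u0 : R -> R) (C : R).
Hypothesis mass1 : total_mass mu0 = 1%E.
Hypothesis C0 : 0 < C.

Definition surviving_mass (D : set R) t : \bar R :=
  (\int[mu0]_(x in D) (phi (x `^ alpha * t) * x)%:E)%E.
Local Notation F := surviving_mass.

Lemma measurable_surviving (D : set R) t : measurable D ->
  measurable_fun D (fun x => (phi (x `^ alpha * t) * x)%:E).
Proof.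
move=> mD; apply/measurable_EFinP; apply: measurable_funM => //.
exact: measurable_phi_powR.
Qed.

(** Small fragments contribute only the lower order t^-q: the bound of [phi_powR_le] is uniform on
    []0, A]] and the initial mass is 1. *)
Lemma surviving_mass_small A t : 0 < A -> 0 < t ->
  (F `]0%R, A] t <= (M * A `^ (gamma - 1) * t `^ (- q))%:E)%E.
Proof.
move=> A0 t0.
have c0 : 0 <= M * A `^ (gamma - 1) * t `^ (- q).
  by rewrite mulr_ge0 ?powR_ge0// mulr_ge0 ?powR_ge0.
apply: (@le_trans _ _ (\int[mu0]_(x in `]0%R, A])
   ((M * A `^ (gamma - 1) * t `^ (- q))%:E * x%:E))%E).
  apply: ge0_le_lower_integral => x; rewrite /= in_itv/= => /andP[x0 xA].
    by rewrite lee_fin mulr_ge0// ltW.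
  rewrite -EFinM lee_fin ler_pM2r// (le_trans (phi_powR_le _ _ x0 t0))//.
  rewrite ler_wpM2r ?powR_ge0// ler_wpM2l//.
  have gamma1 : 0 <= gamma - 1 by move: gamma2; lra.
  by rewrite ge0_ler_powR ?nnegrE ?(ltW x0) ?(ltW A0).
rewrite ge0_integralZl//; last first.
  by move=> x /=; rewrite in_itv/= lee_fin => /andP[/ltW].
rewrite -[leRHS]mule1 lee_wpmul2l ?lee_fin// -mass1.
apply: ge0_subset_integral => //.
- by move=> x /=; rewrite in_itv/= andbT lee_fin => /ltW.
- by move=> x /=; rewrite !in_itv/= andbT => /andP[].
Qed.

Lemma surviving_mass_le (D : set R) t : measurable D -> D `<=` `]0, +oo[ ->
  (F D t <= 1)%E.
Proof.
move=> mD D0; rewrite -mass1.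
apply: (@le_trans _ _ (\int[mu0]_(x in D) x%:E)%E).
  apply: ge0_le_lower_integral => x /D0; rewrite /= in_itv/= andbT => x0.
    by rewrite lee_fin mulr_ge0// ltW.
  by rewrite lee_fin ler_piMl// ltW.
apply: ge0_subset_integral => //.
by move=> x /=; rewrite in_itv/= andbT lee_fin => /ltW.
Qed.

Context (A0 : R).
Hypothesis mfu0 : measurable_fun (`]A0, +oo[ : set R) u0.
Hypothesis u0_ge0 : forall x, A0 < x -> 0 <= u0 x.
Hypothesis mu0E : (forall D : set R, measurable D -> D `<=` `]A0, +oo[ ->
  mu0 D = \int[leb]_(x in D) (u0 x)%:E)%E.

Let FE A t : 0 < A -> A0 <= A -> F `]A, +oo[ t =
  (\int[leb]_(x in `]A, +oo[) (phi (x `^ alpha * t) * x * u0 x)%:E)%E.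
Proof.
move=> A_gt0 A0A; rewrite /F (@integral_density R mu0 u0 A0)//.
- by move=> x /=; rewrite !in_itv/= !andbT; exact: le_lt_trans.
- exact: measurable_surviving.
- move=> x /=; rewrite in_itv/= andbT => Ax.
  by rewrite lee_fin mulr_ge0// ltW// (lt_trans A_gt0).
Qed.

Let JZ A t c : 0 <= c ->
  (\int[leb]_(x in `]A, +oo[) (c * (phi (x `^ alpha * t) * x `^ (1 - gamma)))%:E
   = c%:E * J `]A, +oo[ t)%E.
Proof.
move=> c0; under eq_integral do rewrite EFinM.
by rewrite ge0_integralZl//; exact: mJ.
Qed.

Let powR_gammaE x : 0 < x -> x `^ (1 - gamma) = x * x `^ (- gamma).
Proof.
move=> x0; rewrite powRD; last by rewrite (gt_eqF x0) implybT.
by rewrite powRr1// ltW.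
Qed.

(** The expected equivalent C' t^-p; it is C times [J] over []0, +oo[]. *)
Let g t := `|alpha|^-1 * C * fine K * t `^ (- p).

(** Above A the density lies within a factor 1 - e to 1 + e of C x^-gamma. Below A both the
    surviving mass and [J] are O(t^-q). *)
Lemma surviving_mass_bound e A : 0 < e -> e < 1 -> 0 < A -> A0 <= A ->
  (forall x, A < x -> `|u0 x / (C * x `^ (- gamma)) - 1| < e) ->
  exists2 D : R, 0 <= D & forall t, 0 < t ->
    `|fine (F `]0%R, +oo[ t) - g t| <= e * g t + D * t `^ (- q).
Proof.
move=> e0 e1 A_gt0 A0A u0C.
(* The first summand bounds the surviving mass from []0, A]], the second C times [J] there. *)
exists (M * A `^ (gamma - 1) + C * M * A).
  by rewrite addr_ge0// !mulr_ge0 ?powR_ge0// ltW.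
move=> t t0.
have Kfin : K = (fine K)%:E.
  rewrite fineK// ge0_fin_numE ?tail_constant_lty//.
  by apply: integral_ge0 => x _; rewrite lee_fin mulr_ge0 ?powR_ge0.
have J0 : (0 <= J `]A, +oo[ t)%E by apply: integral_ge0.
have J1 : (0 <= J `]0%R, A] t)%E by apply: integral_ge0.
have CJ : (C%:E * J `]0%R, +oo[ t = (g t)%:E)%E.
  have c0 : 0 < `|alpha| * t `^ p.
    by rewrite mulr_gt0 ?powR_gt0// normr_gt0 lt_eqF.
  have -> : J `]0%R, +oo[ t = ((`|alpha| * t `^ p)^-1%:E * K)%E.
    by rewrite (tail_constantE t)// muleA -EFinM mulVf ?gt_eqF// mul1e.
  rewrite Kfin -!EFinM /g powRN; congr (_%:E).
  by rewrite invfM; ring.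
rewrite (J_split A t)// in CJ.
have u0_le x : A < x -> (1 - e) * C * x `^ (- gamma) <= u0 x <=
    (1 + e) * C * x `^ (- gamma).
  move=> Ax; have x0 := lt_trans A_gt0 Ax.
  have c0 : 0 < C * x `^ (- gamma) by rewrite mulr_gt0// powR_gt0.
  have := u0C x Ax; rewrite ltr_distlC => /andP[/ltW l1 /ltW l2].
  rewrite -!mulrA -(ler_pdivlMr _ _ c0) -(ler_pdivrMr _ _ c0).
  move: (u0 x / _) l1 l2 => v l1 l2.
  by apply/andP; split; move: l1 l2; lra.
(* Finite because its product with C > 0 is the real number [g t]. *)
have Jfin : (J `]0%R, A] t + J `]A, +oo[ t)%E \is a fin_num.
  have J01 := adde_ge0 J1 J0; rewrite ge0_fin_numE// ltNge leye_eq.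
  by apply/eqP => Jy; move: CJ; rewrite Jy gt0_muley ?lte_fin.
move: Jfin; rewrite fin_numD => /andP[ifin jfin].
have jE := esym (fineK jfin); have iE := esym (fineK ifin).
set j := fine (J `]A, +oo[ t) in jE; set i := fine (J `]0%R, A] t) in iE.
have F_ge0 (D : set R) : D `<=` `]0, +oo[ -> (0 <= F D t)%E.
  move=> D0; apply: integral_ge0 => x /D0; rewrite /= in_itv/= andbT => /ltW x0.
  by rewrite lee_fin mulr_ge0.
have D1 : `]0, A] `<=` `]0%R, +oo[.
  by move=> x /=; rewrite !in_itv/= andbT => /andP[].
have D2 : `]A, +oo[ `<=` `]0%R, +oo[.
  by move=> x /=; rewrite !in_itv/= !andbT; exact: lt_trans.
have F_fin (D : set R) : measurable D -> D `<=` `]0, +oo[ ->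
    (fine (F D t))%:E = F D t.
  move=> mD D0; rewrite fineK// ge0_fin_numE ?F_ge0//.
  by rewrite (le_lt_trans (surviving_mass_le _ t mD D0))// ltry.
have m1E := F_fin _ (measurable_itv _) D1.
have m2E := F_fin _ (measurable_itv _) D2.
set m1 := fine (F `]0%R, A] t) in m1E; set m2 := fine (F `]A, +oo[ t) in m2E.
have F12 : F `]0%R, +oo[ t = (m1 + m2)%:E.
  rewrite EFinD m1E m2E.
  rewrite /F {1}(itvoy_split A)// ge0_integral_setU//=.
  - by rewrite -itvoy_split//; exact: measurable_surviving.
  - move=> x [/D1|/D2]; rewrite /= in_itv/= andbT => /ltW x0;
      by rewrite lee_fin mulr_ge0.
  - exact: disjoint_itvoc_oy.
have m1_0 : 0 <= m1 by rewrite -lee_fin m1E F_ge0.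
have := surviving_mass_small A t A_gt0 t0; rewrite -m1E lee_fin => m1_le.
have := J_le A t A_gt0 t0; rewrite iE lee_fin => i_le.
have e1' : 0 <= (1 - e) * C by rewrite mulr_ge0 ?ltW// subr_gt0.
have e1'' : 0 <= (1 + e) * C by rewrite mulr_ge0 ?ltW// addr_gt0.
have m2_ge : (1 - e) * C * j <= m2.
  rewrite -lee_fin EFinM -jE m2E -JZ// FE//.
  apply: ge0_le_lower_integral => x; rewrite /= in_itv/= andbT => Ax.
    by rewrite lee_fin mulr_ge0// mulr_ge0 ?powR_ge0.
  have x0 := lt_trans A_gt0 Ax.
  have /andP[u0_ _] := u0_le x Ax.
  rewrite lee_fin powR_gammaE//.
  rewrite [leLHS](_ : _ =
    phi (x `^ alpha * t) * x * ((1 - e) * C * x `^ (- gamma))); last by ring.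
  by rewrite ler_wpM2l// mulr_ge0// ltW.
have m2_le : m2 <= (1 + e) * C * j.
  rewrite -lee_fin EFinM -jE m2E -JZ// FE//.
  apply: ge0_le_lower_integral => x; rewrite /= in_itv/= andbT => Ax.
    rewrite lee_fin mulr_ge0 ?u0_ge0 ?(le_lt_trans A0A)// mulr_ge0//.
    by rewrite ltW// (lt_trans A_gt0).
  have x0 := lt_trans A_gt0 Ax.
  have /andP[_ u0_] := u0_le x Ax.
  rewrite lee_fin powR_gammaE//.
  rewrite [leRHS](_ : _ =
    phi (x `^ alpha * t) * x * ((1 + e) * C * x `^ (- gamma))); last by ring.
  by rewrite ler_wpM2l// mulr_ge0// ltW.
move: J1; rewrite iE lee_fin => i0.
move: CJ; rewrite iE jE -EFinM => -[CJ].
(* Now the mass is m1 + m2, [g t] is C (i + j), and m2 differs from C j by at most e C j, so the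
   error is at most e C j + m1 + C i. *)
rewrite F12 /= ler_distlC -CJ.
have Ci : C * i <= C * (M * t `^ (- q) * A) by rewrite ler_pM2l.
have eCi : 0 <= e * (C * i) by rewrite mulr_ge0 ?(ltW e0)// mulr_ge0 ?(ltW C0).
have eCi' : e * (C * i) <= C * i by rewrite ler_piMl ?(ltW e1)// mulr_ge0// ltW.
by apply/andP; split; lra.
Qed.

(** Divided by [g t], the bound is e plus a constant multiple of t^(p-q) = t^(1/alpha), which tends
    to 0. *)
Lemma surviving_mass_equiv : 0 < fine K ->
  equivalent_at_pinfty u0 (fun x => C * x `^ (- gamma)) ->
  equivalent_at_pinfty (fun t => fine (F `]0%R, +oo[ t)) g.
Proof.
move=> k0 u0C; apply/cvgrPdist_lt => eta eta0.
pose e := Num.min (eta / 2) (2^-1).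
have e0 : 0 < e by rewrite lt_min !divr_gt0//= invr_gt0.
have e1 : e < 1 by rewrite gt_min invf_lt1 ?ltr1n ?orbT.
have e_eta : e <= eta / 2 by rewrite ge_min lexx.
have [A1 [_ u0A1]] : \forall x \near +oo,
    `|1 - u0 x / (C * x `^ (- gamma))| < e.
  by move/cvgrPdist_lt : u0C; exact.
pose A := Num.max 1 (Num.max A0 A1).
have A_gt0 : 0 < A by rewrite lt_max ltr01.
have A0A : A0 <= A by rewrite !le_max lexx orbT.
have u0A x : A < x -> `|u0 x / (C * x `^ (- gamma)) - 1| < e.
  by rewrite !gt_max => /and3P[_ _ A1x]; rewrite distrC u0A1.
have [D D0 FD] := surviving_mass_bound e A e0 e1 A_gt0 A0A u0A.
pose g1 := `|alpha|^-1 * C * fine K.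
have g1_0 : 0 < g1 by rewrite !mulr_gt0// invr_gt0 normr_gt0 lt_eqF.
(* Adding 1 keeps the divisor positive when D = 0. *)
have c0 : 0 < eta / 2 / (D / g1 + 1).
  by rewrite !divr_gt0// ltr_wpDl// divr_ge0// ltW.
have alphaV0 : alpha^-1 < 0 by rewrite invr_lt0.
have /cvgrPdist_lt small := cvg_powRy _ alphaV0.
have {}small := small _ c0.
near=> t.
have t0 : 0 < t by [].
have gt0 : 0 < g t by rewrite mulr_gt0// powR_gt0.
rewrite distrC -[X in _ - X](divff (lt0r_neq0 gt0)) -mulrBl normrM normfV.
rewrite (gtr0_norm gt0).
rewrite ltr_pdivrMr//; apply: le_lt_trans (FD t t0) _.
have -> : t `^ (- q) = t `^ alpha^-1 * t `^ (- p).
  rewrite -powRD; last by rewrite (gt_eqF t0) implybT.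
  by congr (_ `^ _); field; rewrite lt_eqF.
have small_t : t `^ alpha^-1 < eta / 2 / (D / g1 + 1).
  have : `|0 - t `^ alpha^-1| < eta / 2 / (D / g1 + 1) by near: t.
  by rewrite sub0r normrN ger0_norm ?powR_ge0.
have h : D / g1 * t `^ alpha^-1 < eta / 2.
  apply: (@le_lt_trans _ _ ((D / g1 + 1) * t `^ alpha^-1)).
    by rewrite ler_wpM2r ?powR_ge0// lerDl.
  by rewrite mulrC -ltr_pdivlMr// ltr_wpDl// divr_ge0// ltW.
have -> : D * (t `^ alpha^-1 * t `^ (- p)) = D / g1 * t `^ alpha^-1 * g t.
  by rewrite /g -/g1; field; rewrite gt_eqF.
rewrite -mulrDl ltr_pM2r//.
by move: e_eta h; lra.
Unshelve. all: by end_near. Qed.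

End initial_measure.

End power_tail.

(** * Total mass of the solution and conclusion *)

Lemma total_mass_survival {R : realType} {d : measure_display}
    {T : measurableType d} (P : probability T R) (alpha : R)
    (xi : R -> {RV P >-> R}) (mu0 : {measure set R -> \bar R})
    (mu : R -> {measure set R -> \bar R}) (t : R) :
  constructed_solution alpha xi mu0 mu -> 0 <= t ->
  total_mass (mu t) =
  surviving_mass alpha (fun s => fine (survival P alpha xi s)) mu0 `]0, +oo[ t.
Proof.
move=> sol t0; have [_ muE] := sol t t0.
(* This test function vanishes at 0, as required, and f x * x = x on []0, +oo[]. *)
pose f : R -> R := \1_(`]0, +oo[%classic : set R).
have f1 x : 0 < x -> f x = 1.
  by move=> x0; rewrite /f indicE mem_set//= in_itv/= andbT.
transitivity (\int[mu t]_(x in `]0%R, +oo[) (f x * x)%:E)%E.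
  apply: eq_integral => x; rewrite inE/= in_itv/= andbT => x0.
  by rewrite f1// mul1r.
rewrite muE.
- apply: eq_integral => x; rewrite inE/= in_itv/= andbT => x0.
  rewrite EFinM; congr (_ * _)%E.
  rewrite [RHS]fineK; first exact: survivalE.
  rewrite ge0_fin_numE ?survival_ge0//.
  by rewrite (le_lt_trans (survival_le1 _ _ _ _))// ltry.
- by apply: measurable_funTS; exact: measurable_indic.
- by move=> x _; rewrite /f indicE.
- by rewrite /f indicE memNset//= in_itv/= ltxx.
Qed.

Theorem proposition1p7 (R : realType) (alpha : R)
    (B : {measure set R -> \bar R})
    (d : measure_display) (T : measurableType d) (P : probability T R)
    (xi : R -> {RV P >-> R}) (Pi : {measure set R -> \bar R})
    (mu0 : {measure set R -> \bar R})
    (mu mubar : R -> {measure set R -> \bar R})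
    (u0 : R -> R) (C gamma : R) :
  alpha < 0 ->
  concentrated_on (`]0%R, 1%R[%classic : set R) B ->
  (\int[B]_(y in `]0%R, 1%R[) (y * (1 - y))%:E < +oo)%E ->
  (0 < B `]0%R, 1%R[%classic)%E ->
  image_Levy_measure B Pi ->
  subordinator xi ->
  has_drift_and_Levy_measure xi 0 Pi ->
  concentrated_on (`]0%R, +oo[%classic : set R) mu0 ->
  total_mass mu0 = 1%E ->
  constructed_solution alpha xi mu0 mu ->
  constructed_solution alpha xi (dirac (1 : R)) mubar ->
  density_near_pinfty mu0 u0 ->
  2 < gamma ->
  0 < C ->
  equivalent_at_pinfty u0 (fun x => C * x `^ (- gamma)) ->
  let K := (\int[lebesgue_measure]_(u in `]0%R, +oo[)
    (total_mass (mubar u) * (u `^ ((2 - gamma) / alpha - 1))%:E))%E in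
  let C' := `|alpha|^-1 * C * fine K in
  (K < +oo)%E /\
  equivalent_at_pinfty (fun t => fine (total_mass (mu t)))
    (fun t => C' * t `^ ((gamma - 2) / alpha)).
Proof.
move=> alpha0 _ _ B0 BPi sub levy _ mass1 sol solbar [A0 [mfu u0_ge0 mu0E]].
move=> gamma2 C0 u0C K C'.
pose phi s := fine (survival P alpha xi s).
have phiE s : (phi s)%:E = survival P alpha xi s.
  rewrite fineK// ge0_fin_numE ?survival_ge0//.
  by rewrite (le_lt_trans (survival_le1 _ _ _ _))// ltry.
have phi_ge0 s : 0 <= phi s by rewrite -lee_fin phiE survival_ge0.
have phi_le1 s : phi s <= 1 by rewrite -lee_fin phiE survival_le1.
have phi_le s s' : s <= s' -> phi s' <= phi s.
  by move=> ss'; rewrite -lee_fin !phiE survival_le.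
have q0 : 0 < (1 - gamma) / alpha.
  by rewrite ltr_ndivlMr// mul0r subr_lt0 (lt_trans _ gamma2)// ltr1n.
have [M M0 tail] := subordinator_survival_tail P alpha xi B Pi _ alpha0 B0 BPi
  sub levy q0.
have phi_tail s : 0 < s -> phi s <= M * s `^ (- ((1 - gamma) / alpha)).
  by move=> s0; rewrite -lee_fin phiE tail.
(* For the Dirac mass at 1 the surviving mass at time u is phi (1^alpha u) = phi u. *)
have KE : K = tail_constant alpha gamma phi.
  apply: eq_integral => u; rewrite inE/= in_itv/= andbT => u0'.
  rewrite (total_mass_survival _ _ _ _ _ _ solbar (ltW u0')) -/phi EFinM.
  congr (_ * _)%E; rewrite /surviving_mass integral_dirac//; last first.
    by apply: (measurable_surviving _ _ phi_le); exact: measurable_itv.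
  by rewrite diracE mem_set/= ?in_itv/= ?ltr01// mul1e powR1 mul1r mulr1.
have K_lty : (K < +oo)%E.
  rewrite KE; exact: (tail_constant_lty _ _ M).
split=> //.
(* A positive K makes the equivalent nonzero, so that the quotient is meaningful. *)
have [s s0 phis] : exists2 s, 0 < s & 0 < phi s.
  have nd_xi : forall w s t, 0 <= s -> s <= t -> xi s w <= xi t w by case: sub.
  have [s s0 ss] := survival_gt0 P alpha xi nd_xi alpha0.
  by exists s => //; rewrite -lte_fin phiE.
have K_gt0 : (0 < K)%E by rewrite KE; exact: (tail_constant_gt0 _ _ _ _ _ s).
have k0 : 0 < fine (tail_constant alpha gamma phi).
  by rewrite fine_gt0// -KE K_gt0 K_lty.
have := surviving_mass_equiv _ _ _ _ alpha0 gamma2 M0 phi_ge0 phi_le1 phi_le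
  phi_tail mu0 u0 C mass1 C0 A0 mfu u0_ge0 mu0E k0 u0C.
apply: cvg_trans; apply: near_eq_cvg; near=> t.
have t0 : 0 <= t by [].
rewrite (total_mass_survival _ _ _ _ _ _ sol t0) /C' KE.
by rewrite -mulNr opprB.
Unshelve. all: by end_near. Qed.
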